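(* Let $q\in(0,1)$ and $\alpha,\beta\in(0,1)$. Then $$\lim_{x \rightarrow \infty}[x]_q^{\beta-\alpha}\,\frac{\Gamma_{q}(x+\alpha)}{\Gamma_{q}(x+\beta)}=1.$$
   Context: Here $q,\alpha,\beta$ are fixed and $x\to\infty$ through positive reals. For $q\in(0,1)$ and real $x$, $[x]_q=\frac{1-q^x}{1-q}$, and $[x]_q^{\beta-\alpha}$ means $([x]_q)^{\beta-\alpha}$. The $q$-deformed Gamma function is defined for $q\in(0,1)$ and $x>0$ by $$\Gamma_q(x)=(1-q)^{1-x}\prod_{n=0}^{\infty}\frac{1-q^{n+1}}{1-q^{n+x}},$$ equivalently by the Jackson integral $\Gamma_q(x)=\int_0^{1/(1-q)} t^{x-1}E_q^{-qt}\,d_qt$, where $\int_0^a f(t)\,d_qt=(1-q)a\sum_{n=0}^\infty f(aq^n)q^n$ and $E_q^{t}=\prod_{i=0}^{\infty}(1+(1-q)tq^i)$. *)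

(* Defs.v *)
From HB Require Import structures.
From mathcomp Require Import all_boot all_order all_algebra.
From mathcomp Require Import all_classical all_reals all_analysis.

Set Implicit Arguments.
Unset Strict Implicit.
Unset Printing Implicit Defensive.

Import Order.TTheory GRing.Theory Num.Theory.
Import numFieldNormedType.Exports.

Local Open Scope classical_set_scope.
Local Open Scope ring_scope.

Definition qnumber (R : realType) (q x : R) : R := (1 - q `^ x) / (1 - q).

(* Meaningful for 0 < q < 1 and 0 < x, where the partial products converge to
   a positive real; elsewhere the value is irrelevant. *)
Definition qGamma (R : realType) (q x : R) : R :=
  (1 - q) `^ (1 - x) *
  limn (fun N : nat =>
    \prod_(0 <= n < N) ((1 - q ^+ n.+1) / (1 - q `^ (n%:R + x)))).

(* Main.v *)
Require Import Defs.
From HB Require Import structures.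
From mathcomp Require Import all_boot all_order all_algebra.
From mathcomp Require Import all_classical all_reals all_analysis.
From mathcomp Require Import ring.

Set Implicit Arguments.
Unset Strict Implicit.
Unset Printing Implicit Defensive.

Import Order.TTheory GRing.Theory Num.Theory.
Import numFieldNormedType.Exports.

Local Open Scope classical_set_scope.
Local Open Scope ring_scope.

(** In terms of the q-Pochhammer symbol (z; q)_oo = prod_n (1 - z q^n), for x > 0,
    Gamma_q(x) = (1 - q)^(1 - x) (q; q)_oo / (q^x; q)_oo.  Hence the expression in
    the limit equals
    (1 - q^x)^(beta - alpha) (q^(x + beta); q)_oo / (q^(x + alpha); q)_oo,
    and every factor tends to 1 because q^x -> 0 and
    1 - z / (1 - q) <= (z; q)_oo <= 1 for 0 <= z <= 1. *)

Definition qpochhammer (R : realType) (q z : R) (N : nat) : R :=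
  \prod_(0 <= n < N) (1 - z * q ^+ n).

Definition qpochhammer_lim (R : realType) (q z : R) : R :=
  limn (qpochhammer q z).

Section QPochhammer.
Variables (R : realType) (q : R).
Hypotheses (q0 : 0 < q) (q1 : q < 1).
Implicit Types (z x y : R) (k m N : nat).

Lemma qpochhammerS z N :
  qpochhammer q z N.+1 = qpochhammer q z N * (1 - z * q ^+ N).
Proof. by rewrite /qpochhammer big_nat_recr. Qed.

(** Splitting off a head of length [k] replaces [z] by [z * q ^+ k], which is as small as desired;
    this is what makes positivity of the infinite product accessible. *)
Lemma qpochhammerD z k m :
  qpochhammer q z (k + m) = qpochhammer q z k * qpochhammer q (z * q ^+ k) m.
Proof.
elim: m => [|m IH].
  by rewrite addn0 {3}/qpochhammer big_geq// mulr1.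
by rewrite addnS !qpochhammerS IH exprD !mulrA.
Qed.

Lemma qpochhammer_factor_itv z N : 0 <= z <= 1 -> 0 <= 1 - z * q ^+ N <= 1.
Proof.
move=> /andP[z0 z1]; have qN0 : 0 <= q ^+ N by rewrite exprn_ge0// ltW.
have qN1 : q ^+ N <= 1 by rewrite exprn_ile1// ltW.
by rewrite subr_ge0 mulr_ile1//= gerBl mulr_ge0.
Qed.

Lemma qpochhammer_itv z N : 0 <= z <= 1 -> 0 <= qpochhammer q z N <= 1.
Proof.
move=> z01; elim: N => [|N /andP[IH0 IH1]].
  by rewrite /qpochhammer big_geq// ler01 lexx.
have /andP[f0 f1] := qpochhammer_factor_itv N z01.
by rewrite qpochhammerS mulr_ge0//= mulr_ile1.
Qed.

Lemma qpochhammer_gt0 z N : 0 <= z < 1 -> 0 < qpochhammer q z N.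
Proof.
move=> /andP[z0 z1]; rewrite /qpochhammer prodr_gt0// => n _.
rewrite subr_gt0 (le_lt_trans _ z1)// ler_piMr// exprn_ile1// ltW//.
Qed.

Lemma qpochhammer_nonincreasing z :
  0 <= z <= 1 -> nonincreasing_seq (qpochhammer q z).
Proof.
move=> z01; apply/nonincreasing_seqP => N.
have /andP[f0 f1] := qpochhammer_factor_itv N z01.
have /andP[p0 _] := qpochhammer_itv N z01.
by rewrite qpochhammerS ler_piMr.
Qed.

(* Weierstrass' inequality [\prod (1 - a_n) >= 1 - \sum a_n], with the
   geometric sum in closed form. *)
Lemma qpochhammer_ge z N :
  0 <= z <= 1 -> 1 - z / (1 - q) <= qpochhammer q z N.
Proof.
move=> z01; have z0 : 0 <= z by case/andP: z01.
have q'0 : 0 < 1 - q by rewrite subr_gt0.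
(* The bound without [N] is not inductive. With the partial geometric sum, passing from [N] to
   [N.+1] lowers the left side by exactly [z * q ^+ N], and the product by at most that, since the
   product so far is at most 1. *)
suff : 1 - z / (1 - q) * (1 - q ^+ N) <= qpochhammer q z N.
  apply: le_trans; rewrite lerD2l lerN2 ler_piMr ?divr_ge0 ?(ltW q'0)//.
  by rewrite gerBl exprn_ge0// ltW.
elim: N => [|N IH].
  by rewrite /qpochhammer big_geq// expr0 subrr mulr0 subr0.
have /andP[_ p1] := qpochhammer_itv N z01.
have zq0 : 0 <= z * q ^+ N by rewrite mulr_ge0// exprn_ge0// ltW.
have -> : 1 - z / (1 - q) * (1 - q ^+ N.+1) =
          1 - z / (1 - q) * (1 - q ^+ N) - z * q ^+ N.
  by rewrite exprS; field; rewrite gt_eqF.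
rewrite qpochhammerS [leRHS]mulrBr mulr1; apply: lerB => //.
by rewrite ler_piMl.
Qed.

Lemma is_cvg_qpochhammer z : 0 <= z <= 1 -> cvgn (qpochhammer q z).
Proof.
move=> z01; apply: nonincreasing_is_cvgn; first exact: qpochhammer_nonincreasing.
by exists 0 => _ [N _ <-]; case/andP: (qpochhammer_itv N z01).
Qed.

Lemma qpochhammer_lim_ge z :
  0 <= z <= 1 -> 1 - z / (1 - q) <= qpochhammer_lim q z.
Proof.
move=> z01; apply: limr_ge; first exact: is_cvg_qpochhammer.
by apply: nearW => N; exact: qpochhammer_ge.
Qed.

Lemma qpochhammer_lim_le1 z : 0 <= z <= 1 -> qpochhammer_lim q z <= 1.
Proof.
move=> z01; apply: limr_le; first exact: is_cvg_qpochhammer.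
by apply: nearW => N; case/andP: (qpochhammer_itv N z01).
Qed.

(* Once [z * q ^+ k < 1 - q], Weierstrass' inequality bounds the tail product
   starting at [k] away from [0]. *)
Lemma qpochhammer_lim_gt0 z : 0 <= z < 1 -> 0 < qpochhammer_lim q z.
Proof.
move=> /andP[z0 z1].
have z01 : 0 <= z <= 1 by rewrite z0 ltW.
have q'0 : 0 < 1 - q by rewrite subr_gt0.
have [k zk] : exists k, z * q ^+ k < 1 - q.
  have /cvg_expr/cvgr_lt/(_ _ q'0)[k _ /(_ k (leqnn k)) qk] : `|q| < 1.
    by rewrite ger0_norm// ltW.
  exists k; apply: le_lt_trans qk.
  by rewrite ler_piMl ?ltW// exprn_gt0.
have zk01 : 0 <= z * q ^+ k <= 1.
  rewrite mulr_ge0 ?exprn_ge0 ?(ltW q0)//= (le_trans (ltW zk))// gerBl.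
  exact: ltW.
apply: (@lt_le_trans _ _ (qpochhammer q z k * (1 - z * q ^+ k / (1 - q)))).
  rewrite mulr_gt0 ?qpochhammer_gt0 ?z0//.
  by rewrite subr_gt0 ltr_pdivrMr// mul1r.
apply: limr_ge; first exact: is_cvg_qpochhammer.
near=> N.
have kN : (k <= N)%N by near: N; exact: nbhs_infty_ge.
rewrite -(subnKC kN) qpochhammerD ler_wpM2l//.
  by case/andP: (qpochhammer_itv k z01).
exact: qpochhammer_ge.
Unshelve. all: by end_near. Qed.

(** Since [ln q < 0], the exponent in [expR ((x + a) * ln q)] tends to minus infinity. *)
Lemma cvg_powR_pinfty a : q `^ (x + a) @[x --> +oo] --> 0.
Proof.
have lq0 : 0 < - ln q by rewrite oppr_gt0 ln_lt0// q0.
have -> : (fun x => q `^ (x + a)) = (fun x => expR (- ((x + a) * (- ln q)))).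
  by apply/funext => x; rewrite /powR gt_eqF// mulrN opprK.
have lin : (x + a) * (- ln q) @[x --> +oo] --> (+oo : set_system R).
  by apply: gt0_cvgMly => //; exact: cvg_addrr.
exact: cvg_comp lin (@cvgr_expR R).
Qed.

Lemma powR_itv x : 0 < x -> 0 <= q `^ x < 1.
Proof.
move=> x0; rewrite powR_ge0 /powR gt_eqF//= expR_lt1.
by rewrite pmulr_rlt0// ln_lt0// q0.
Qed.

Lemma cvg_qpochhammer_lim_powR a :
  qpochhammer_lim q (q `^ (x + a)) @[x --> +oo] --> (1 : R).
Proof.
apply: (@squeeze_cvgr _ _ _ _ (fun x => 1 - q `^ (x + a) / (1 - q)) (fun=> 1)).
- near=> x.
  have /powR_itv/andP[qx0 /ltW qx1] : 0 < x + a.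
    by rewrite -ltrBlDr sub0r; near: x; apply: nbhs_pinfty_gt; rewrite num_real.
  by rewrite qpochhammer_lim_ge ?qpochhammer_lim_le1// qx0.
- have lim1 : (1 : R) = 1 - 0 / (1 - q) by rewrite mul0r subr0.
  rewrite [X in _ --> X]lim1.
  by apply: cvgB; [exact: cvg_cst|apply: cvgMr_tmp; exact: cvg_powR_pinfty].
- exact: cvg_cst.
Unshelve. all: by end_near. Qed.

(** Factor by factor, [q ^+ n.+1] is [q * q ^+ n] and [q]^ (n%:R + x)[is]q [^ x * q ^+ n]. The limit
    passes through the quotient because the limit of the denominators is positive. *)
Lemma qGammaE x : 0 < x ->
  qGamma q x =
  (1 - q) `^ (1 - x) * (qpochhammer_lim q q / qpochhammer_lim q (q `^ x)).
Proof.
move=> x0; have qx := powR_itv x0.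
have qx_le : 0 <= q `^ x <= 1 by case/andP: qx => -> /ltW ->.
have qq_le : 0 <= q <= 1 by rewrite !ltW.
rewrite /qGamma; congr (_ * _); apply: cvg_lim => //.
have -> : (fun N => \prod_(0 <= n < N) ((1 - q ^+ n.+1) / (1 - q `^ (n%:R + x))))
    = (fun N => qpochhammer q q N * (qpochhammer q (q `^ x) N)^-1).
  apply/funext => N; rewrite /qpochhammer -prodfV -big_split/=.
  apply: eq_bigr => n _; rewrite exprS powRD ?(gt_eqF q0) ?implybT//.
  by rewrite powR_mulrn ?ltW// [_ * q `^ x]mulrC.
apply: cvgM; first exact: is_cvg_qpochhammer.
apply: cvgV; first by rewrite gt_eqF// qpochhammer_lim_gt0.
exact: is_cvg_qpochhammer.
Qed.

End QPochhammer.

Lemma cvg_powR1 (R : realType) (T : Type) (F : set_system T) (f : T -> R)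
    (r : R) : Filter F ->
  f x @[x --> F] --> (1 : R) -> f x `^ r @[x --> F] --> (1 : R).
Proof.
move=> FF f1.
have : expR (r * ln (f x)) @[x --> F] --> (1 : R).
  rewrite -[X in _ --> X]expR0 -[X in expR X](mulr0 r) -[X in r * X](@ln1 R).
  apply: continuous_cvg; first exact: continuous_expR.
  apply: cvgMl_tmp; apply: continuous_cvg => //.
  exact: continuous_ln.
apply: cvg_trans; apply: near_eq_cvg; near=> x.
(* [powR] treats base 0 separately, so it agrees with the exponential form only where [f x] is
   nonzero; [f] is eventually positive because its limit is 1. *)
rewrite /powR gt_eqF//; near: x; exact: (cvgr_gt _ f1).
Unshelve. all: by end_near. Qed.

Theorem mainTheorem4 (R : realType) (q alpha beta : R)
    (hq0 : 0 < q) (hq1 : q < 1)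
    (halpha0 : 0 < alpha) (halpha1 : alpha < 1)
    (hbeta0 : 0 < beta) (hbeta1 : beta < 1) :
  (qnumber q x) `^ (beta - alpha) * (qGamma q (x + alpha) / qGamma q (x + beta))
    @[x --> +oo] --> (1 : R).
Proof.
set P := fun a x => qpochhammer_lim q (q `^ (x + a)).
have q'0 : 0 < 1 - q by rewrite subr_gt0.
have : (1 - q `^ x) `^ (beta - alpha) * (P beta x * (P alpha x)^-1)
    @[x --> +oo] --> (1 : R).
  rewrite -[X in _ --> X]mulr1; apply: cvgM.
    apply: cvg_powR1; rewrite -[X in _ --> X]subr0.
    apply: cvgB; first exact: cvg_cst.
    have := cvg_powR_pinfty hq0 hq1 0.
    by under eq_fun do rewrite addr0.
  rewrite -[X in _ --> X]mulr1; apply: cvgM.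
    exact: cvg_qpochhammer_lim_powR.
  rewrite -[X in _ --> X]invr1; apply: cvgV; first exact: oner_neq0.
  exact: cvg_qpochhammer_lim_powR.
(* It remains to identify this function with the original one for [x > 0]. *)
apply: cvg_trans; apply: near_eq_cvg; near=> x.
have x0 : 0 < x by near: x; apply: nbhs_pinfty_gt; rewrite num_real.
have Pne0 a : 0 < a -> P a x != 0.
  by move=> a0; rewrite gt_eqF// qpochhammer_lim_gt0// powR_itv// addr_gt0.
have Cne0 : qpochhammer_lim q q != 0.
  by rewrite gt_eqF// qpochhammer_lim_gt0// ltW.
have /andP[_ qx1] := powR_itv hq0 hq1 x0.
rewrite !qGammaE ?addr_gt0// -!/(P _ x) /qnumber.
rewrite powRM ?subr_ge0 ?invr_ge0 ?ltW// -(powR_inv1 (ltW q'0)) -powRrM mulN1r.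
have qV a b : (1 - q) `^ (1 - (x + a)) =
    (1 - q) `^ (1 - (x + b)) * (1 - q) `^ (b - a).
  by rewrite -powRD ?(gt_eqF q'0) ?implybT//; congr (_ `^ _); ring.
rewrite (qV alpha beta) powRN; field.
by rewrite Cne0 !Pne0// !gt_eqF ?powR_gt0.
Unshelve. all: by end_near. Qed.
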